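(* Let $A$ and $B$ be Banach algebras and let $\phi\in Hom(B,\mathbb{C})$. Then there is an algebraic isomorphism $$Z\left((A\oplus_\phi B)^{\ast\ast}\right)\cong Z(A^{\ast\ast})\oplus_\phi Z(B^{\ast\ast}).$$
   Context: $Hom(B,\mathbb{C})$ is the set of all nonzero homomorphisms from $B$ into $\mathbb{C}$. $A\oplus_\phi B$ is the Banach algebra of all ordered pairs $(a,b)$, $a\in A$, $b\in B$, with coordinatewise addition and scalar multiplication, product $(a_1,a_2)\cdot_\phi(b_1,b_2)=(a_1b_1+\phi(a_2)b_1+\phi(b_2)a_1,\ a_2b_2)$, and norm $\|(a_1,a_2)\|_{\oplus_\phi}=\|a_1\|+\|a_2\|$. For a Banach algebra $C$, the bidual $C^{\ast\ast}$ is a Banach algebra under the following Arens product: for $f\in C^\ast$, $a,b\in C$, $m,n\in C^{\ast\ast}$, $\langle f\cdot a,b\rangle=\langle f,ab\rangle$, $\langle m\cdot f,a\rangle=\langle m,f\cdot a\rangle$, $\langle n\cdot m,f\rangle=\langle n,m\cdot f\rangle$. The topological centre of $C^{\ast\ast}$ is the closed subalgebra $Z(C^{\ast\ast})=\{m\in C^{\ast\ast}:\ \text{the map } n\mapsto m\cdot n \text{ is } w^\ast\text{-}w^\ast\text{ continuous on } C^{\ast\ast}\}$, where $w^\ast=\sigma(C^{\ast\ast},C^\ast)$. $Z(A^{\ast\ast})\oplus_\phi Z(B^{\ast\ast})$ is the algebra of all pairs $(m_1,m_2)$, $m_1\in Z(A^{\ast\ast})$, $m_2\in Z(B^{\ast\ast})$,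 with coordinatewise linear operations and product $(m_1,m_2)\odot_\phi(m_1',m_2')=(m_1\cdot m_1'+m_2(\phi)m_1'+m_2'(\phi)m_1,\ m_2\cdot m_2')$. *)

(* Defs.v *)
From HB Require Import structures.
From mathcomp Require Import all_boot all_order all_algebra complex.
From mathcomp Require Import all_classical all_reals topology normedtype sequences.

Set Implicit Arguments.
Unset Strict Implicit.
Unset Printing Implicit Defensive.

Import Order.TTheory GRing.Theory Num.Theory.
Import numFieldNormedType.Exports.

Local Open Scope classical_set_scope.
Local Open Scope ring_scope.
Local Open Scope complex_scope.

Reserved Notation "x ** y" (at level 40, left associativity).

(* Algebras need not be unital here, whereas the rings of ssralg are. *)
HB.mixin Record Lmodule_isNAlgebra (K : numFieldType) A
    of GRing.Lmodule K A := {
  nmul : A -> A -> A;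
  nmulA : associative nmul;
  nmulDl : left_distributive nmul +%R;
  nmulDr : right_distributive nmul +%R;
  nscalerAl : forall (k : K) (x y : A), k *: nmul x y = nmul (k *: x) y;
  nscalerAr : forall (k : K) (x y : A), k *: nmul x y = nmul x (k *: y)
}.

#[short(type="nalgType")]
HB.structure Definition NAlgebra (K : numFieldType) :=
  {A of GRing.Lmodule K A & Lmodule_isNAlgebra K A}.

Notation "x ** y" := (nmul x y) : ring_scope.

HB.mixin Record NAlgebra_isBanach (K : numFieldType) A
    of CompleteNormedModule K A & NAlgebra K A := {
  ler_norm_nmul : forall x y : A, `|x ** y| <= `|x| * `|y|
}.

#[short(type="banachAlgType")]
HB.structure Definition BanachAlgebra (K : numFieldType) :=
  {A of CompleteNormedModule K A & NAlgebra K A & NAlgebra_isBanach K A}.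

Definition alg_isomorphic (K : numFieldType) (A B : nalgType K) : Prop :=
  exists f : {linear A -> B}, bijective f /\ {morph f : x y / x ** y}.

(* Hom(B, K): continuity is not assumed, see ler_character below. *)
Record character (K : numFieldType) (B : nalgType K) := Character {
  char_fun :> {linear B -> K^o};
  charM : forall x y, char_fun (x ** y) = char_fun x * char_fun y;
  char_neq0 : exists x, char_fun x != 0
}.

(* phi does not occur in the body: it is there for the instances below. *)
Definition lau_sum (K : numFieldType) (A B : nalgType K) (phi : character B)
  : Type := (A * B)%type.
Arguments lau_sum {K} A B phi.

Section LauSum.
Context (K : numFieldType) (A B : nalgType K) (phi : character B).
Local Notation L := (lau_sum A B phi).

HB.instance Definition _ := GRing.Lmodule.copy L (A * B)%type.

Definition lau_mul (x y : L) : L :=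
  (x.1 ** y.1 + phi x.2 *: y.1 + phi y.2 *: x.1, x.2 ** y.2).

Let lau_mulA : associative lau_mul.
Proof.
move=> [a1 a2] [b1 b2] [c1 c2]; rewrite /lau_mul /=; congr pair; last exact: nmulA.
rewrite !charM !nmulDl !nmulDr nmulA !scalerDr !scalerA -!nscalerAl -!nscalerAr.
rewrite [phi c2 * phi a2]mulrC [phi c2 * phi b2]mulrC.
by rewrite (AC (3*3*1) ((1*4*2)*5*(3*6*7))).
Qed.

Let lau_mulDl : left_distributive lau_mul +%R.
Proof.
move=> [a1 a2] [b1 b2] [c1 c2]; rewrite /lau_mul /=.
congr pair => /=; last exact: nmulDl.
by rewrite nmulDl (linearD phi) scalerDl scalerDr (AC (2*2*2) ((1*3*5)*(2*4*6))).
Qed.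

Let lau_mulDr : right_distributive lau_mul +%R.
Proof.
move=> [a1 a2] [b1 b2] [c1 c2]; rewrite /lau_mul /=.
congr pair => /=; last exact: nmulDr.
by rewrite nmulDr (linearD phi) scalerDl scalerDr (AC (2*2*2) ((1*3*5)*(2*4*6))).
Qed.

Let lau_scalerAl (k : K) (x y : L) :
  k *: lau_mul x y = lau_mul (k *: x) y.
Proof.
case: x y => [a1 a2] [b1 b2]; rewrite /lau_mul /=.
congr pair => /=; last exact: nscalerAl.
rewrite !scalerDr !scalerA nscalerAl [phi (k *: _)]linearZ /= -[k *: phi _]/(k * phi _).
by rewrite [phi b2 * k]mulrC.
Qed.

Let lau_scalerAr (k : K) (x y : L) :
  k *: lau_mul x y = lau_mul x (k *: y).
Proof.
case: x y => [a1 a2] [b1 b2]; rewrite /lau_mul /=.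
congr pair => /=; last exact: nscalerAr.
rewrite !scalerDr !scalerA nscalerAr [phi (k *: _)]linearZ /= -[k *: phi _]/(k * phi _).
by rewrite [phi a2 * k]mulrC.
Qed.

HB.instance Definition _ := Lmodule_isNAlgebra.Build K L
  lau_mulA lau_mulDl lau_mulDr lau_scalerAl lau_scalerAr.

End LauSum.

Section Dual.
Context (R : realType) (V : normedModType R[i]).

Definition dual_pred : {pred V -> R[i]^o} :=
  fun f => `[< linear f /\ continuous f >].

Record dual := Dual { dual_fun :> V -> R[i]^o; _ : dual_fun \in dual_pred }.

HB.instance Definition _ := [isSub for dual_fun].
HB.instance Definition _ := [Choice of dual by <:].

Let dual_pred_closed : submod_closed dual_pred.
Proof.
split.
  apply/asboolP; split; last by move=> x; exact: cvg_cst.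
  by move=> k x y; rewrite /= scaler0 addr0.
move=> k f g /asboolP[lf cf] /asboolP[lg cg]; apply/asboolP; split.
  move=> a x y; rewrite !fctE lf lg !scalerDr !scalerA [a * k]mulrC.
  by rewrite !addrA; congr (_ + _); rewrite addrAC.
move=> x; apply: cvgD; last exact: cg.
by apply: cvgZl_tmp; exact: cf.
Qed.

HB.instance Definition _ := GRing.isSubmodClosed.Build _ _ dual_pred dual_pred_closed.
HB.instance Definition _ := [SubChoice_isSubLmodule of dual by <:].

Lemma dualP (f : dual) : linear f /\ continuous f.
Proof. by apply/asboolP; exact: (valP f). Qed.

HB.instance Definition _ (f : dual) :=
  GRing.isLinear.Build R[i] V R[i]^o *:%R f (dualP f).1.

Lemma dual_ext (f g : dual) : (forall x, f x = g x) -> f = g.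
Proof. by move=> fg; apply/val_inj/funext. Qed.

Lemma dual_bounded (f : dual) :
  exists2 M : R[i], 0 < M & forall x, `|f x| <= M * `|x|.
Proof.
have cf : continuous (f : {linear V -> R[i]^o}) := (dualP f).2.
have /linear_boundedP bf := (linear_bounded_continuous _).2 cf.
by have [M M0 fM] := pinfty_ex_gt0 bf; exists M.
Qed.

Lemma bounded_dual (f : V -> R[i]^o) (M : R[i]) : linear f -> 0 <= M ->
  (forall x, `|f x| <= M * `|x|) -> f \in dual_pred.
Proof.
move=> lf M0 fM; apply/asboolP; split => //.
pose g : {linear V -> R[i]^o} :=
  HB.pack f (GRing.isLinear.Build R[i] V R[i]^o *:%R f lf).
apply: (bounded_linear_continuous (f := g)); apply/linear_boundedP.
near=> r => x; rewrite (le_trans (fM x))// ler_wpM2r//.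
by near: r; apply: nbhs_pinfty_ge; exact: ger0_real.
Unshelve. all: by end_near. Qed.

(* The norm of a normedModType over R[i] takes its values in R[i]; the real
   part only serves to take the supremum in R. *)
Definition dual_norm (f : dual) : R[i] :=
  (sup [set complex.Re `|f x| | x in [set x : V | `|x| <= 1]])%:C.

Let ReK (x : R[i]) : 0 <= x -> (complex.Re x)%:C = x.
Proof. by move=> x0; rewrite RRe_real// ger0_real. Qed.

Let dual_norm_has_sup (f : dual) :
  has_sup [set complex.Re `|f x| | x in [set x : V | `|x| <= 1]].
Proof.
split; first by exists (complex.Re `|f 0|), 0; rewrite //= normr0.
have [M M0 fM] := dual_bounded f; exists (complex.Re M) => _ [x /= x1 <-].
rewrite -lecR !ReK ?(ltW M0)// (le_trans (fM x))//.
by rewrite -[leRHS]mulr1 ler_wpM2l// ltW.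
Qed.

Let dual_norm_ge0 (f : dual) : 0 <= dual_norm f.
Proof.
rewrite ler0c; apply: (@le_trans _ _ (complex.Re `|f 0|)).
  by rewrite -ler0c ReK.
by apply: sup_upper_bound => //; exists 0; rewrite //= normr0.
Qed.

Let ler_dual_norm (f : dual) (x : V) : `|f x| <= dual_norm f * `|x|.
Proof.
have [->|x0] := eqVneq x 0; first by rewrite linear0 !normr0 mulr0.
have nx0 : 0 < `|x| by rewrite normr_gt0.
rewrite -ler_pdivrMr// mulrC.
have -> : `|x|^-1 * `|f x| = `|f (`|x|^-1 *: x)|.
  by rewrite linearZ [RHS]normrM ger0_norm// invr_ge0.
rewrite -[leLHS]ReK// lecR.
apply: sup_upper_bound => //; exists (`|x|^-1 *: x) => //=.
by rewrite normrZ ger0_norm ?invr_ge0// mulVf// gt_eqF.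
Qed.

Let dual_norm_ler (f : dual) (M : R[i]) : 0 <= M ->
  (forall x, `|f x| <= M * `|x|) -> dual_norm f <= M.
Proof.
move=> M0 fM; rewrite -(ReK M0) lecR; apply: ge_sup.
  by case: (dual_norm_has_sup f).
move=> _ [x /= x1 <-]; rewrite -lecR !ReK// (le_trans (fM x))//.
by rewrite -[leRHS]mulr1 ler_wpM2l.
Qed.

Let dual_normD (f g : dual) : dual_norm (f + g) <= dual_norm f + dual_norm g.
Proof.
apply: dual_norm_ler => [|x]; first by rewrite addr_ge0.
by rewrite mulrDl (le_trans (ler_normD _ _))// lerD.
Qed.

Let dual_normZ (k : R[i]) (f : dual) : dual_norm (k *: f) = `|k| * dual_norm f.
Proof.
have le_normZ l g : dual_norm (l *: g) <= `|l| * dual_norm g.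
  apply: dual_norm_ler => [|x]; first by rewrite mulr_ge0.
  by rewrite -mulrA [leLHS]normrM ler_wpM2l.
apply/eqP; rewrite eq_le le_normZ/=.
have [->|k0] := eqVneq k 0; first by rewrite normr0 mul0r.
rewrite -ler_pdivlMl ?normr_gt0// -normfV.
by rewrite -[X in dual_norm X <= _](scalerK k0) le_normZ.
Qed.

Let dual_norm_eq0 (f : dual) : dual_norm f = 0 -> f = 0.
Proof.
move=> f0; apply: dual_ext => x; apply/eqP; rewrite -normr_le0.
by rewrite (le_trans (ler_dual_norm f x))// f0 mul0r.
Qed.

HB.instance Definition _ :=
  Lmodule_isNormed.Build R[i] dual dual_normD dual_normZ dual_norm_eq0.

Lemma ler_dualM (f : dual) (x : V) : `|f x| <= `|f| * `|x|.
Proof. exact: ler_dual_norm. Qed.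

Lemma dual_ler_norm (f : dual) (M : R[i]) : 0 <= M ->
  (forall x, `|f x| <= M * `|x|) -> `|f| <= M.
Proof. exact: dual_norm_ler. Qed.

(* sigma(V', V), i.e. pointwise convergence on V *)
Definition wstar := initial_topology (dual_fun : dual -> {ptws V -> R[i]^o}).

HB.instance Definition _ := Topological.on wstar.

Lemma wstar_continuousP (T : topologicalType) (F : T -> wstar) :
  continuous F <-> forall x : V, continuous (fun t => dual_fun (F t) x).
Proof.
split=> [cF x t|cF].
  have ci : continuous (dual_fun : wstar -> {ptws V -> R[i]^o}).
    exact: initial_continuous.
  have cx : continuous (fun g : {ptws V -> R[i]^o} => g x).
    exact: (@proj_continuous V (fun _ => R[i]^o) x).
  apply: (continuous_comp (f := F) (g := fun m : wstar => dual_fun m x)).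
    exact: cF.
  exact: (continuous_comp (ci _) (cx _)).
apply: continuous_comp_initial => t.
by apply/pointwise_cvgP => x; exact: cF.
Qed.

End Dual.

Definition bidual (R : realType) (V : normedModType R[i]) : Type :=
  dual (dual V).

(* First Arens product: <f.a, b> = <f, ab>, <m.f, a> = <m, f.a> and
   <n.m, f> = <n, m.f>. *)
Section Arens.
Context (R : realType) (C : banachAlgType R[i]).

HB.instance Definition _ := NormedModule.copy (bidual C) (dual (dual C)).

Section RightAction.
Context (f : dual C) (a : C).

Definition dual_act_fun : C -> R[i]^o := fun b => f (a ** b).

Let dual_act_fun_linear : linear dual_act_fun.
Proof. by move=> k x y; rewrite /dual_act_fun nmulDr -nscalerAr linearP. Qed.

Let dual_act_fun_bounded b : `|dual_act_fun b| <= (`|f| * `|a|) * `|b|.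
Proof.
by rewrite (le_trans (ler_dualM _ _))// -mulrA ler_wpM2l// ler_norm_nmul.
Qed.

Let dual_act_fun_dual : dual_act_fun \in @dual_pred R C.
Proof.
by apply: bounded_dual dual_act_fun_bounded => //; rewrite mulr_ge0.
Qed.

Definition dual_act : dual C := Dual dual_act_fun_dual.

Lemma norm_dual_act : `|dual_act| <= `|f| * `|a|.
Proof. by apply: dual_ler_norm => //; rewrite mulr_ge0. Qed.

End RightAction.

Section LeftAction.
Context (m : bidual C) (f : dual C).

Definition bidual_act_fun : C -> R[i]^o := fun a => m (dual_act f a).

Let bidual_act_fun_linear : linear bidual_act_fun.
Proof.
move=> k x y; rewrite /bidual_act_fun.
have -> : dual_act f (k *: x + y) = k *: dual_act f x + dual_act f y.
  by apply: dual_ext => b; rewrite /= /dual_act_fun nmulDl -nscalerAl linearP.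
by rewrite linearP.
Qed.

Let bidual_act_fun_bounded a : `|bidual_act_fun a| <= (`|m| * `|f|) * `|a|.
Proof.
by rewrite (le_trans (ler_dualM _ _))// -mulrA ler_wpM2l// norm_dual_act.
Qed.

Let bidual_act_fun_dual : bidual_act_fun \in @dual_pred R C.
Proof.
by apply: bounded_dual bidual_act_fun_bounded => //; rewrite mulr_ge0.
Qed.

Definition bidual_act : dual C := Dual bidual_act_fun_dual.

Lemma norm_bidual_act : `|bidual_act| <= `|m| * `|f|.
Proof. by apply: dual_ler_norm => //; rewrite mulr_ge0. Qed.

End LeftAction.

Lemma bidual_act_linear (m : bidual C) : linear (bidual_act m).
Proof.
move=> k f g; apply: dual_ext => a; rewrite /= /bidual_act_fun.
have -> : dual_act (k *: f + g) a = k *: dual_act f a + dual_act g a.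
  exact: dual_ext.
by rewrite linearP.
Qed.

Section Product.
Context (n m : bidual C).

Definition arens_fun : dual C -> R[i]^o := fun f => n (bidual_act m f).

Let arens_fun_linear : linear arens_fun.
Proof. by move=> k f g; rewrite /arens_fun bidual_act_linear linearP. Qed.

Let arens_fun_bounded f : `|arens_fun f| <= (`|n| * `|m|) * `|f|.
Proof.
by rewrite (le_trans (ler_dualM _ _))// -mulrA ler_wpM2l// norm_bidual_act.
Qed.

Let arens_fun_dual : arens_fun \in @dual_pred R (dual C).
Proof.
by apply: bounded_dual arens_fun_bounded => //; rewrite mulr_ge0.
Qed.

Definition arens : bidual C := Dual arens_fun_dual.

End Product.

Let arensA : associative arens.
Proof.
move=> m n p; apply: dual_ext => f; congr (dual_fun m _).
apply: dual_ext => a; congr (dual_fun n _).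
apply: dual_ext => b; congr (dual_fun p _).
by apply: dual_ext => c; rewrite /= /dual_act_fun nmulA.
Qed.

Let arensDl : left_distributive arens +%R.
Proof. by move=> m n p; apply: dual_ext. Qed.

Let arensDr : right_distributive arens +%R.
Proof.
move=> m n p; apply: dual_ext => f; rewrite /= /arens_fun.
have -> : bidual_act (n + p) f = bidual_act n f + bidual_act p f.
  exact: dual_ext.
by rewrite linearD.
Qed.

Let arens_scalerAl (k : R[i]) (m n : bidual C) :
  k *: arens m n = arens (k *: m) n.
Proof. exact: dual_ext. Qed.

Let arens_scalerAr (k : R[i]) (m n : bidual C) :
  k *: arens m n = arens m (k *: n).
Proof.
apply: dual_ext => f; rewrite /= /arens_fun.
have -> : bidual_act (k *: n) f = k *: bidual_act n f by exact: dual_ext.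
by rewrite linearZ.
Qed.

HB.instance Definition _ := Lmodule_isNAlgebra.Build R[i] (bidual C)
  arensA arensDl arensDr arens_scalerAl arens_scalerAr.

End Arens.

Section TopologicalCentre.
Context (R : realType) (C : banachAlgType R[i]).

Definition topcenter_pred : {pred bidual C} := fun m =>
  `[< continuous ((fun n : bidual C => m ** n)
        : wstar (dual C) -> wstar (dual C)) >].

Record topcenter :=
  TopCenter { topcenter_val :> bidual C; _ : topcenter_val \in topcenter_pred }.

HB.instance Definition _ := [isSub for topcenter_val].
HB.instance Definition _ := [Choice of topcenter by <:].

Let continuous_lincomb (T : topologicalType) (k : R[i]) (g h : T -> R[i]^o) :
  continuous g -> continuous h -> continuous (fun t => k *: g t + h t).
Proof.
move=> cg ch t; apply: cvgD; last exact: ch.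
by apply: cvgZl_tmp; exact: cg.
Qed.

Let topcenter_pred_closed : submod_closed topcenter_pred.
Proof.
split.
  apply/asboolP/wstar_continuousP => f.
  rewrite (_ : (fun _ => _) = fun=> 0); last exact/funext.
  exact: cst_continuous.
move=> k m n /asboolP/wstar_continuousP cm /asboolP/wstar_continuousP cn.
apply/asboolP/wstar_continuousP => f.
exact: (@continuous_lincomb _ k _ _ (cm f) (cn f)).
Qed.

HB.instance Definition _ :=
  GRing.isSubmodClosed.Build _ _ topcenter_pred topcenter_pred_closed.
HB.instance Definition _ := [SubChoice_isSubLmodule of topcenter by <:].

Let topcenter_pred_mul (m n : topcenter) :
  topcenter_val m ** topcenter_val n \in topcenter_pred.
Proof.
have /asboolP cm := valP m; have /asboolP cn := valP n; apply/asboolP.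
pose M (x : bidual C) : wstar (dual C) -> wstar (dual C) :=
  fun n : bidual C => x ** n.
rewrite -[X in continuous X]/(M _).
have -> : M (topcenter_val m ** topcenter_val n) =
          M (topcenter_val m) \o M (topcenter_val n).
  by apply/funext => p; rewrite /M /= nmulA.
by move=> p; apply: continuous_comp; [exact: cn|exact: cm].
Qed.

Definition topcenter_mul (m n : topcenter) : topcenter :=
  TopCenter (topcenter_pred_mul m n).

Let topcenter_mulA : associative topcenter_mul.
Proof. by move=> x y z; apply: val_inj; exact: nmulA. Qed.

Let topcenter_mulDl : left_distributive topcenter_mul +%R.
Proof. by move=> x y z; apply: val_inj; exact: nmulDl. Qed.

Let topcenter_mulDr : right_distributive topcenter_mul +%R.
Proof. by move=> x y z; apply: val_inj; exact: nmulDr. Qed.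

Let topcenter_scalerAl (k : R[i]) (m n : topcenter) :
  k *: topcenter_mul m n = topcenter_mul (k *: m) n.
Proof. by apply: val_inj; exact: nscalerAl. Qed.

Let topcenter_scalerAr (k : R[i]) (m n : topcenter) :
  k *: topcenter_mul m n = topcenter_mul m (k *: n).
Proof. by apply: val_inj; exact: nscalerAr. Qed.

HB.instance Definition _ := Lmodule_isNAlgebra.Build R[i] topcenter
  topcenter_mulA topcenter_mulDl topcenter_mulDr
  topcenter_scalerAl topcenter_scalerAr.

End TopologicalCentre.

Section CharacterContinuity.
Context (R : realType) (B : banachAlgType R[i]) (phi : character B).

Section Geometric.
Context (c : B) (c1 : `|c| < 1).

Let u (k : nat) : B := iter k (nmul c) c.

Let norm_u k : `|u k| <= (complex.Re `|c| * complex.Re `|c| ^+ k)%:C.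
Proof.
rewrite rmorphM rmorphXn /= RRe_real ?normr_real//.
elim: k => [|k IHk]; first by rewrite expr0 mulr1.
by rewrite (le_trans (ler_norm_nmul _ _))// exprS ler_wpM2l.
Qed.

Let cvg_u : cvgn (series u).
Proof.
apply/cauchy_cvgP/cauchy_seriesP => e e0.
have r0 : 0 <= complex.Re `|c| by rewrite -ler0c RRe_real ?normr_real.
have r1 : `|complex.Re `|c| | < 1.
  by rewrite ger0_norm// -ltcR RRe_real ?normr_real.
have /cvg_cauchy/cauchy_seriesP := @is_cvg_geometric_series R (complex.Re `|c|) _ r1.
have eE : e = (complex.Re e)%:C by rewrite RRe_real// gtr0_real.
have Re0 : 0 < complex.Re e by rewrite -ltcR -eE.
move=> /(_ _ Re0); apply: filterS => -[m n] /= smn.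
rewrite eE (le_lt_trans (ler_norm_sum _ _ _))//.
rewrite (@le_lt_trans _ _ (\sum_(m <= k < n) geometric (complex.Re `|c|) (complex.Re `|c|) k)%:C)//.
  by rewrite rmorph_sum ler_sum.
by rewrite ltcR (le_lt_trans (ler_norm _)).
Qed.

Lemma geometric_fixpoint : exists l : B, l = c + c ** l.
Proof.
exists (limn (series u)).
have cc : continuous (nmul c).
  move=> x; apply/cvgrPdist_lt => e e0.
  have /cvgrPdist_lt/(_ e e0) : y @[y --> x] --> x by exact: cvg_id.
  apply: filterS => y xy; rewrite -scaleN1r nscalerAr -nmulDr scaleN1r.
  rewrite (le_lt_trans (ler_norm_nmul _ _))//.
  by rewrite (le_lt_trans _ xy)// ler_piMl// ltW.
have sE n : series u n.+1 = c + c ** series u n.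
  elim: n => [|n IHn].
    rewrite /series /= big_nat1 big_geq//= (_ : c ** 0 = 0) ?addr0//.
    by apply: (addrI (c ** 0)); rewrite -nmulDr !addr0.
  by rewrite seriesSr [in RHS]seriesSr IHn nmulDr addrA.
have h1 : series u n.+1 @[n --> \oo] --> limn (series u).
  by rewrite (cvg_shiftS (series u)).
have h2 : series u n.+1 @[n --> \oo] --> c + c ** limn (series u).
  rewrite (_ : (fun n => series u n.+1) = fun n => c + c ** series u n).
    apply: cvgD; first exact: cvg_cst.
    by apply: (continuous_cvg _ (cc _)).
  exact/funext.
exact: (cvg_unique _ h1 h2).
Qed.

End Geometric.

Lemma ler_character (b : B) : `|phi b| <= `|b|.
Proof.
rewrite real_leNgt ?normr_real//; apply/negP => lt_b.
have pb0 : phi b != 0 by rewrite -normr_gt0 (le_lt_trans _ lt_b).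
pose c := (phi b)^-1 *: b.
have c1 : `|c| < 1 by rewrite normrZ normfV ltr_pdivrMl ?normr_gt0// mulr1.
have pc : phi c = 1 by rewrite linearZ /= [LHS]mulVf.
have [l /(congr1 phi)/eqP] := geometric_fixpoint c1.
rewrite linearD charM pc mul1r -[eqbLHS]add0r (inj_eq (addIr _)).
by rewrite eq_sym oner_eq0.
Qed.

Let char_dual : (phi : B -> R[i]^o) \in @dual_pred R B.
Proof.
apply: (@bounded_dual _ _ _ 1) => // [k x y|x]; first exact: linearP.
by rewrite mul1r ler_character.
Qed.

Definition character_dual : dual B := Dual char_dual.

End CharacterContinuity.

Section LauBanach.
Context (R : realType) (A B : banachAlgType R[i]) (phi : character B).
Local Notation L := (lau_sum A B phi).

Definition lau_norm (x : L) : R[i] := `|x.1| + `|x.2|.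

Let lau_normD (x y : L) : lau_norm (x + y) <= lau_norm x + lau_norm y.
Proof. by rewrite /lau_norm addrACA lerD// ler_normD. Qed.

Let lau_normZ (k : R[i]) (x : L) : lau_norm (k *: x) = `|k| * lau_norm x.
Proof. by rewrite /lau_norm mulrDr !normrZ. Qed.

Let lau_norm_eq0 (x : L) : lau_norm x = 0 -> x = 0.
Proof.
case: x => a b /eqP; rewrite /lau_norm paddr_eq0// !normr_eq0 /=.
by move=> /andP[/eqP -> /eqP ->].
Qed.

HB.instance Definition _ :=
  Lmodule_isNormed.Build R[i] L lau_normD lau_normZ lau_norm_eq0.

Let lau_complete (F : set_system L) : ProperFilter F -> cauchy F -> cvg F.
Proof.
move=> FF /cauchyP cF.
have cF1 : cauchy (fst @ F : set_system A).
  apply/cauchyP => e e0; have [x Fx] := cF e e0; exists x.1.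
  rewrite /= nbhs_simpl; apply: filterS Fx => y.
  rewrite -!ball_normE /=; apply: le_lt_trans.
  by rewrite [leRHS]/(lau_norm _) /lau_norm lerDl.
have cF2 : cauchy (snd @ F : set_system B).
  apply/cauchyP => e e0; have [x Fx] := cF e e0; exists x.2.
  rewrite /= nbhs_simpl; apply: filterS Fx => y.
  rewrite -!ball_normE /=; apply: le_lt_trans.
  by rewrite [leRHS]/(lau_norm _) /lau_norm lerDr.
have Fa : fst @ F --> lim (fst @ F : set_system A) by exact: cauchy_cvg.
have Fb : snd @ F --> lim (snd @ F : set_system B) by exact: cauchy_cvg.
apply/cvg_ex; exists ((lim (fst @ F), lim (snd @ F)) : L).
apply/cvgrPdist_lt => e e0; near=> x.
rewrite [ltLHS]/(lau_norm _) /lau_norm (splitr e) ltrD//=.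
- near: x; move/cvgrPdist_lt : Fa => /(_ (e / 2)); apply.
  by rewrite divr_gt0.
- near: x; move/cvgrPdist_lt : Fb => /(_ (e / 2)); apply.
  by rewrite divr_gt0.
Unshelve. all: by end_near. Qed.

HB.instance Definition _ := Uniform_isComplete.Build L lau_complete.

Let lau_norm_mul (x y : L) : `|x ** y| <= `|x| * `|y|.
Proof.
case: x y => [a1 a2] [b1 b2].
rewrite [leLHS]/(lau_norm _) [`|(a1, a2) : L|]/(lau_norm _).
rewrite [`|(b1, b2) : L|]/(lau_norm _) /lau_norm /=.
rewrite mulrDl !mulrDr.
rewrite (AC (2*2) ((1*3*2)*4)) lerD ?ler_norm_nmul//.
rewrite (le_trans (ler_normD _ _))// lerD//; last first.
  by rewrite normrZ mulrC ler_wpM2l// ler_character.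
rewrite (le_trans (ler_normD _ _))// lerD ?ler_norm_nmul//.
by rewrite normrZ ler_wpM2r// ler_character.
Qed.

HB.instance Definition _ := NAlgebra_isBanach.Build R[i] L lau_norm_mul.

End LauBanach.

Section BidualCharacter.
Context (R : realType) (B : banachAlgType R[i]) (phi : character B).

Definition bidual_char_fun (m : topcenter B) : R[i]^o :=
  topcenter_val m (character_dual phi).

Let bidual_char_linear : linear bidual_char_fun.
Proof. by []. Qed.

HB.instance Definition _ := GRing.isLinear.Build R[i] (topcenter B) R[i]^o *:%R
  bidual_char_fun bidual_char_linear.

Let bidual_charM (m n : topcenter B) :
  bidual_char_fun (m ** n) = bidual_char_fun m * bidual_char_fun n.
Proof.
rewrite /bidual_char_fun /= /arens_fun.
have -> : bidual_act (topcenter_val n) (character_dual phi) =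
    bidual_char_fun n *: character_dual phi.
  apply: dual_ext => a; rewrite /= /bidual_act_fun.
  have -> : dual_act (character_dual phi) a = phi a *: character_dual phi.
    by apply: dual_ext => b; rewrite /= /dual_act_fun /= charM.
  by rewrite linearZ /=; exact: mulrC.
by rewrite linearZ /=; exact: mulrC.
Qed.

Section Evaluation.
Context (b : B).

Definition eval_fun : dual B -> R[i]^o := fun f => f b.

Let eval_dual : eval_fun \in @dual_pred R (dual B).
Proof.
apply: (@bounded_dual _ _ _ `|b|) => // f.
by rewrite mulrC ler_dualM.
Qed.

Definition eval : bidual B := Dual eval_dual.

Let eval_topcenter : eval \in @topcenter_pred R B.
Proof.
apply/asboolP/wstar_continuousP => f.
have cid : continuous (@idfun (wstar (dual B))) by move=> m; exact: cvg_id.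
exact: ((wstar_continuousP _).1 cid (dual_act f b)).
Qed.

Definition eval_center : topcenter B := TopCenter eval_topcenter.

End Evaluation.

Let bidual_char_neq0 : exists m, bidual_char_fun m != 0.
Proof. by have [b pb] := char_neq0 phi; exists (eval_center b). Qed.

(* The product of lau_sum for this character is the paper's product on
   Z(A'') (+) Z(B''): the scalars phi x.2 and phi y.2 become m_2(phi), m_2'(phi). *)
Definition bidual_character : character (topcenter B) :=
  Character bidual_charM bidual_char_neq0.

End BidualCharacter.

(* Main.v *)
(** Since [A (+)_phi B] is, as a Banach space, a direct sum, an element [M] of
    its bidual is a pair [(M1, M2)]; computing the Arens product coordinatewise
    gives [M N = (M1 N1 + M2(phi) N1 + N2(phi) M1, M2 N2)].  The terms other
    than [M1 N1] and [M2 N2] are a scalar times a coordinate of [N], or a fixed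
    element times a w*-continuous scalar, so they are w*-continuous in [N]
    whatever [M] is: [M] lies in the topological centre if and only if [M1] and
    [M2] do. *)
Require Import Defs.
From HB Require Import structures.
From mathcomp Require Import all_boot all_order all_algebra complex.
From mathcomp Require Import all_classical all_reals topology normedtype.

Set Implicit Arguments.
Unset Strict Implicit.
Unset Printing Implicit Defensive.

Import Order.TTheory GRing.Theory Num.Theory.
Import numFieldNormedType.Exports.

Local Open Scope ring_scope.
Local Open Scope complex_scope.

Lemma nmul0r (K : numFieldType) (A : nalgType K) (x : A) : 0 ** x = 0.
Proof. by apply: (addIr (0 ** x)); rewrite -nmulDl !add0r. Qed.

Lemma nmulr0 (K : numFieldType) (A : nalgType K) (x : A) : x ** 0 = 0.
Proof. by apply: (addIr (x ** 0)); rewrite -nmulDr !add0r. Qed.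

(** * Bounded operators, their transposes and w*-continuity *)

Record bounded_op (R : realType) (V W : normedModType R[i]) := BoundedOp {
  bop_fun :> V -> W;
  bop_linear : linear bop_fun;
  bop_bounded : exists2 M : R[i], 0 <= M & forall x, `|bop_fun x| <= M * `|x|
}.

HB.instance Definition _ (R : realType) (V W : normedModType R[i])
    (T : bounded_op V W) :=
  GRing.isLinear.Build R[i] V W *:%R T (bop_linear T).

Section Transpose.
Context (R : realType) (V W : normedModType R[i]) (T : bounded_op V W).

(** Serves twice: it makes [g \o T] a bounded functional, and it gives the transpose the same bound
    [M]. *)
Let comp_bop_bounded (g : dual W) (M : R[i]) :
  (forall x, `|T x| <= M * `|x|) -> forall x, `|g (T x)| <= (M * `|g|) * `|x|.
Proof.
move=> TM x; rewrite (le_trans (ler_dualM _ _))//.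
by rewrite mulrAC mulrC ler_wpM2r.
Qed.

Let comp_bop_dual (g : dual W) : (g \o T : V -> R[i]^o) \in @dual_pred R V.
Proof.
have [M M0 TM] := bop_bounded T.
apply: (bounded_dual _ _ (comp_bop_bounded g TM)); last by rewrite mulr_ge0.
by move=> k x y; rewrite /= !linearP.
Qed.

Definition transpose_fun (g : dual W) : dual V := Dual (comp_bop_dual g).

Let transpose_linear : linear transpose_fun.
Proof. by move=> k f g; exact: dual_ext. Qed.

Let transpose_bounded :
  exists2 M : R[i], 0 <= M & forall g, `|transpose_fun g| <= M * `|g|.
Proof.
have [M M0 TM] := bop_bounded T; exists M => // g.
apply: dual_ler_norm; first by rewrite mulr_ge0.
exact: comp_bop_bounded.
Qed.

(** The result is again a [bounded_op], so a second transposition carries an operator to the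
    biduals. *)
Definition transpose : bounded_op (dual W) (dual V) :=
  BoundedOp transpose_linear transpose_bounded.

End Transpose.

Lemma continuous_lincomb (R : realType) (T : topologicalType) (k : R[i])
    (g h : T -> R[i]^o) :
  continuous g -> continuous h ->
  continuous ((fun t => k * g t + h t) : T -> R[i]^o).
Proof.
by move=> cg ch t; apply: cvgD (ch t); exact: (cvgZl_tmp (k := k) (cg t)).
Qed.

Lemma wstar_eval_continuous (R : realType) (V : normedModType R[i]) (x : V) :
  continuous (fun f : wstar V => dual_fun f x).
Proof.
(* Continuity into [wstar V] is tested by evaluations; applied to the identity, the test yields the
   evaluations themselves. *)
suff /wstar_continuousP : continuous (@idfun (wstar V)) by exact.
by move=> f; exact: cvg_id.
Qed.

(** The value of [transpose T g] at [x] is that of [g] at [T x], an evaluation of [g] at a fixed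
    point. *)
Lemma transpose_wstar_continuous (R : realType) (V W : normedModType R[i])
  (T : bounded_op V W) : continuous (transpose T : wstar W -> wstar V).
Proof. by apply/wstar_continuousP => x; exact: wstar_eval_continuous. Qed.

Lemma topcenterP (R : realType) (C : banachAlgType R[i]) (m : bidual C) :
  m \in @topcenter_pred R C <->
  forall f : dual C,
    continuous (fun n : wstar (dual C) => (m ** (n : bidual C)) f).
Proof.
by split=> [/asboolP/wstar_continuousP//|h]; apply/asboolP/wstar_continuousP.
Qed.

(** * Coordinates on the direct sum, its dual and its bidual *)

Section LauBidual.
Context (R : realType) (A B : banachAlgType R[i]) (phi : character B).
Local Notation L := (lau_sum A B phi).
Local Notation phi' := (character_dual phi).

Let fst_linear : linear (fst : L -> A). Proof. by []. Qed.
Let snd_linear : linear (snd : L -> B). Proof. by []. Qed.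

Let inl_linear : linear ((fun a => (a, 0)) : A -> L).
Proof. by move=> k x y; congr pair; rewrite /= scaler0 addr0. Qed.

Let inr_linear : linear ((fun b => (0, b)) : B -> L).
Proof. by move=> k x y; congr pair; rewrite /= scaler0 addr0. Qed.

Lemma norm_lauE (x : L) : `|x| = `|x.1| + `|x.2|.
Proof. by []. Qed.

(** This operator and the next three are transparent, so that their composites and transposes
    compute and many identities below hold by conversion. *)
Definition lau_fst : bounded_op L A.
Proof.
apply: (BoundedOp fst_linear); exists 1 => // x.
by rewrite mul1r norm_lauE lerDl.
Defined.

Definition lau_snd : bounded_op L B.
Proof.
apply: (BoundedOp snd_linear); exists 1 => // x.
by rewrite mul1r norm_lauE lerDr.
Defined.

Definition lau_inl : bounded_op A L.
Proof.
apply: (BoundedOp inl_linear); exists 1 => // x.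
by rewrite mul1r norm_lauE /= normr0 addr0.
Defined.

Definition lau_inr : bounded_op B L.
Proof.
apply: (BoundedOp inr_linear); exists 1 => // x.
by rewrite mul1r norm_lauE /= normr0 add0r.
Defined.

(** Since [(a, b) = (a, 0) + (0, b)], [f] is determined by its restrictions f1 and f2 to the two
    summands, pulled back along the projections. *)
Lemma dual_lau_split (f : dual L) :
  f = transpose lau_fst (transpose lau_inl f) +
      transpose lau_snd (transpose lau_inr f).
Proof.
apply: dual_ext => -[a b] /=; rewrite -[RHS](linearD f).
by congr (dual_fun f (_, _)); rewrite /= ?addr0 ?add0r.
Qed.

(** Second transposes of the projections and injections; the first two give the coordinates M1 and
    M2 of [M]. *)
Definition bidual_fst (M : bidual L) : bidual A :=
  transpose (transpose lau_fst) M.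
Definition bidual_snd (M : bidual L) : bidual B :=
  transpose (transpose lau_snd) M.
Definition bidual_inl (m : bidual A) : bidual L :=
  transpose (transpose lau_inl) m.
Definition bidual_inr (m : bidual B) : bidual L :=
  transpose (transpose lau_inr) m.

Lemma bidual_lauE (M : bidual L) (f : dual L) :
  M f = bidual_fst M (transpose lau_inl f) + bidual_snd M (transpose lau_inr f).
Proof. by rewrite {1}(dual_lau_split f) linearD. Qed.

Lemma bidual_lau_ext (M N : bidual L) :
  bidual_fst M = bidual_fst N -> bidual_snd M = bidual_snd N -> M = N.
Proof. by move=> e1 e2; apply: dual_ext => f; rewrite !bidual_lauE e1 e2. Qed.

Lemma inl_fst (g : dual A) : transpose lau_inl (transpose lau_fst g) = g.
Proof. exact: dual_ext. Qed.

Lemma inl_snd (h : dual B) : transpose lau_inl (transpose lau_snd h) = 0.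
Proof. by apply: dual_ext => a; exact: linear0. Qed.

Lemma inr_fst (g : dual A) : transpose lau_inr (transpose lau_fst g) = 0.
Proof. by apply: dual_ext => a; exact: linear0. Qed.

Lemma inr_snd (h : dual B) : transpose lau_inr (transpose lau_snd h) = h.
Proof. exact: dual_ext. Qed.

Lemma bidual_fst_inl m : bidual_fst (bidual_inl m) = m.
Proof. by apply: dual_ext => g; congr (dual_fun m _); exact: inl_fst. Qed.

Lemma bidual_fst_inr m : bidual_fst (bidual_inr m) = 0.
Proof.
apply: dual_ext => g.
by transitivity (m 0); [congr (dual_fun m _); exact: inr_fst|exact: linear0].
Qed.

Lemma bidual_snd_inl m : bidual_snd (bidual_inl m) = 0.
Proof.
apply: dual_ext => h.
by transitivity (m 0); [congr (dual_fun m _); exact: inl_snd|exact: linear0].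
Qed.

Lemma bidual_snd_inr m : bidual_snd (bidual_inr m) = m.
Proof. by apply: dual_ext => h; congr (dual_fun m _); exact: inr_snd. Qed.

(** * The module actions and the Arens product in coordinates *)

(** Because [phi 0 = 0], the product of [x] and [(a, 0)] is [(x.1 ** a + phi x.2 *: a, 0)]. *)
Lemma dual_act_inl (f : dual L) (x : L) :
  transpose lau_inl (dual_act f x) =
  dual_act (transpose lau_inl f) x.1 + phi x.2 *: transpose lau_inl f.
Proof.
apply: dual_ext => a.
transitivity (f (lau_inl (x.1 ** a) + phi x.2 *: lau_inl a)); last first.
  by rewrite linearD linearZ.
congr (dual_fun f _); rewrite [LHS]/(lau_mul _ _) /lau_mul /=.
rewrite linear0 scale0r addr0; congr pair.
(* The second coordinate of the sum in [L], written out by conversion so that the rules of [B] can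
   rewrite it. *)
transitivity (0 + phi x.2 *: (0 : B)); last by [].
by rewrite nmulr0 scaler0 addr0.
Qed.

(** The product of [x] and [(0, b)] is [(phi b *: x.1, x.2 ** b)]; as [b] varies, the scalar [phi b]
    becomes the functional [phi']. *)
Lemma dual_act_inr (f : dual L) (x : L) :
  transpose lau_inr (dual_act f x) =
  transpose lau_inl f x.1 *: phi' + dual_act (transpose lau_inr f) x.2.
Proof.
apply: dual_ext => b.
transitivity (f (phi b *: lau_inl x.1 + lau_inr (x.2 ** b))); last first.
  by rewrite linearD linearZ; congr (_ + _); exact: mulrC.
congr (dual_fun f _); rewrite [LHS]/(lau_mul _ _) /lau_mul /=.
rewrite scaler0 addr0; congr pair.
  transitivity (phi b *: x.1 + (0 : A)); last by [].
  by rewrite nmulr0 add0r addr0.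
transitivity (phi b *: (0 : B) + x.2 ** b); last by [].
by rewrite scaler0 add0r.
Qed.

(** For [x = (a, 0)] the two preceding formulas give f.x the coordinates f1.a and f1(a) [phi'], to
    which N1 and N2 are applied. *)
Lemma bidual_act_inl (N : bidual L) (f : dual L) :
  transpose lau_inl (bidual_act N f) =
  bidual_act (bidual_fst N) (transpose lau_inl f) +
  bidual_snd N phi' *: transpose lau_inl f.
Proof.
apply: dual_ext => a; apply: etrans (bidual_lauE N _) _.
rewrite dual_act_inl dual_act_inr linear0 scale0r addr0; congr (_ + _).
have -> : dual_act (transpose lau_inr f) (lau_inl a).2 = 0.
  apply: dual_ext => b; rewrite /= /dual_act_fun /=.
  rewrite -[RHS](linear0 f); congr (dual_fun f (_, _)).
  exact: nmul0r.
by rewrite addr0 linearZ; exact: mulrC.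
Qed.

(** For [x = (0, b)] the coordinates of f.x are [phi b] f1 and f2.b. *)
Lemma bidual_act_inr (N : bidual L) (f : dual L) :
  transpose lau_inr (bidual_act N f) =
  bidual_fst N (transpose lau_inl f) *: phi' +
  bidual_act (bidual_snd N) (transpose lau_inr f).
Proof.
apply: dual_ext => b; apply: etrans (bidual_lauE N _) _.
rewrite dual_act_inl dual_act_inr linear0 scale0r add0r; congr (_ + _).
have -> : dual_act (transpose lau_inl f) (lau_inr b).1 = 0.
  apply: dual_ext => a; rewrite /= /dual_act_fun /=.
  rewrite -[RHS](linear0 f); congr (dual_fun f (_, _)).
  exact: nmul0r.
by rewrite add0r linearZ; exact: mulrC.
Qed.

(** Expand [M] at N.f as M1 at its first coordinate plus M2 at its second. This scalar form yields
    both the product formulas and the continuity arguments below. *)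
Lemma bidual_lau_mulE (M N : bidual L) (f : dual L) :
  (M ** N) f =
    (bidual_fst M ** bidual_fst N) (transpose lau_inl f)
    + bidual_snd N phi' * bidual_fst M (transpose lau_inl f)
    + bidual_snd M phi' * bidual_fst N (transpose lau_inl f)
    + (bidual_snd M ** bidual_snd N) (transpose lau_inr f).
Proof.
apply: etrans (bidual_lauE M _) _; rewrite bidual_act_inl bidual_act_inr.
rewrite !linearD !linearZ /= !addrA; congr (_ + _ + _).
exact: mulrC.
Qed.

(** Testing on functionals with coordinates (g, 0) removes the last term of [bidual_lau_mulE]; in
    [bidual_sndM], testing on (0, h) leaves only that term. *)
Lemma bidual_fstM (M N : bidual L) :
  bidual_fst (M ** N) = bidual_fst M ** bidual_fst N
    + bidual_snd M phi' *: bidual_fst N + bidual_snd N phi' *: bidual_fst M.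
Proof.
apply: dual_ext => g; apply: etrans (bidual_lau_mulE M N _) _.
rewrite inl_fst inr_fst linear0 addr0.
by rewrite addrAC.
Qed.

Lemma bidual_sndM (M N : bidual L) :
  bidual_snd (M ** N) = bidual_snd M ** bidual_snd N.
Proof.
apply: dual_ext => h; apply: etrans (bidual_lau_mulE M N _) _.
by rewrite inl_snd inr_snd !linear0 !mulr0 !add0r.
Qed.

(** * The topological centre in coordinates *)

(** Multiply [M] by (n, 0) and evaluate at (g, 0): the result is (M1 n)(g) + M2(phi) n(g), so (M1
    n)(g) is a difference of two w*-continuous functions of n. *)
Lemma topcenter_bidual_fst (M : bidual L) :
  M \in @topcenter_pred R L -> bidual_fst M \in @topcenter_pred R A.
Proof.
move=> /topcenterP cM; apply/topcenterP => g.
have ci : continuous (bidual_inl : wstar (dual A) -> wstar (dual L)).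
  exact: transpose_wstar_continuous.
have ce : continuous (fun n : wstar (dual A) => dual_fun n g).
  exact: wstar_eval_continuous.
have cMi : continuous (fun n : wstar (dual A) =>
    (M ** bidual_inl n) (transpose lau_fst g)).
  by move=> n; exact: (continuous_comp (ci n) (cM _ _)).
have -> : (fun n : wstar (dual A) => (bidual_fst M ** (n : bidual A)) g) =
    (fun n : wstar (dual A) => - bidual_snd M phi' * dual_fun n g +
       (M ** bidual_inl n) (transpose lau_fst g)).
  apply/funext => n; rewrite bidual_lau_mulE inl_fst inr_fst linear0 addr0.
  by rewrite bidual_snd_inl bidual_fst_inl mul0r addr0 mulNr addrC addrK.
exact: continuous_lincomb ce cMi.
Qed.

(** Multiplying by (0, n) and evaluating at (0, h) gives (M2 n)(h) with no correction term. *)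
Lemma topcenter_bidual_snd (M : bidual L) :
  M \in @topcenter_pred R L -> bidual_snd M \in @topcenter_pred R B.
Proof.
move=> /topcenterP cM; apply/topcenterP => h.
have -> : (fun n : wstar (dual B) => (bidual_snd M ** (n : bidual B)) h) =
    (fun n : wstar (dual B) => (M ** bidual_inr n) (transpose lau_snd h)).
  apply/funext => n; rewrite bidual_lau_mulE inl_snd inr_snd !linear0.
  by rewrite !mulr0 !add0r bidual_snd_inr.
have ci : continuous (bidual_inr : wstar (dual B) -> wstar (dual L)).
  exact: transpose_wstar_continuous.
by move=> n; exact: (continuous_comp (ci n) (cM _ _)).
Qed.

Lemma topcenter_lau (M : bidual L) :
  bidual_fst M \in @topcenter_pred R A ->
  bidual_snd M \in @topcenter_pred R B ->
  M \in @topcenter_pred R L.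
Proof.
move=> /topcenterP cM1 /topcenterP cM2; apply/topcenterP => f.
have c1 : continuous (bidual_fst : wstar (dual L) -> wstar (dual A)).
  exact: transpose_wstar_continuous.
have c2 : continuous (bidual_snd : wstar (dual L) -> wstar (dual B)).
  exact: transpose_wstar_continuous.
pose f1 := transpose lau_inl f; pose f2 := transpose lau_inr f.
have cN1 : continuous (fun N : wstar (dual L) => bidual_fst N f1).
  move=> N.
  exact: (continuous_comp (c1 N) (@wstar_eval_continuous _ _ f1 _)).
have cN2 : continuous (fun N : wstar (dual L) => bidual_snd N phi').
  move=> N.
  exact: (continuous_comp (c2 N) (@wstar_eval_continuous _ _ phi' _)).
have cMN1 : continuous (fun N : wstar (dual L) =>
    (bidual_fst M ** bidual_fst N) f1).
  by move=> N; exact: (continuous_comp (c1 N) (cM1 _ _)).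
have cMN2 : continuous (fun N : wstar (dual L) =>
    (bidual_snd M ** bidual_snd N) f2).
  by move=> N; exact: (continuous_comp (c2 N) (cM2 _ _)).
(* The four terms are nested as combinations [k * g + h] to fit [continuous_lincomb]; the factor 1
   puts the term of M1 N1 into this shape. *)
have -> : (fun N : wstar (dual L) => (M ** (N : bidual L)) f) =
    (fun N : wstar (dual L) =>
       bidual_snd M phi' * bidual_fst N f1 +
       (bidual_fst M f1 * bidual_snd N phi' +
        (1 * (bidual_fst M ** bidual_fst N) f1 +
         (bidual_snd M ** bidual_snd N) f2))).
  apply/funext => N; rewrite bidual_lau_mulE mul1r.
  by rewrite [_ * bidual_fst M _]mulrC (AC (3*1) (3*(2*(1*4)))).
have c3 := continuous_lincomb (k := 1) cMN1 cMN2.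
exact: (continuous_lincomb cN1 (continuous_lincomb cN2 c3)).
Qed.

(** * The isomorphism between the topological centres *)

Definition topcenter_split (M : topcenter L) :
    lau_sum (topcenter A) (topcenter B) (bidual_character phi) :=
  (TopCenter (topcenter_bidual_fst (valP M)),
   TopCenter (topcenter_bidual_snd (valP M))).

Lemma topcenter_split_linear : linear topcenter_split.
Proof. by move=> k M N; congr pair; apply: val_inj; exact: dual_ext. Qed.

HB.instance Definition _ := GRing.isLinear.Build R[i] (topcenter L)
  (lau_sum (topcenter A) (topcenter B) (bidual_character phi)) *:%R
  topcenter_split topcenter_split_linear.

(** As [bidual_character phi] takes the value M2(phi) at M2, the two coordinate formulas are exactly
    those of [lau_mul] for this character. *)
Lemma topcenter_splitM : {morph topcenter_split : M N / M ** N}.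
Proof.
move=> M N; congr pair; apply: val_inj; first exact: bidual_fstM.
exact: bidual_sndM.
Qed.

Lemma topcenter_split_bij : bijective topcenter_split.
Proof.
(* The inverse map adds the two embedded coordinates; [topcenter_lau] shows that it lands in the
   centre. *)
pose joinf (m : topcenter A * topcenter B) : bidual L :=
  bidual_inl (topcenter_val m.1) + bidual_inr (topcenter_val m.2).
have fst_join m : bidual_fst (joinf m) = m.1.
  transitivity (bidual_fst (bidual_inl m.1) + bidual_fst (bidual_inr m.2)).
    exact: dual_ext.
  by rewrite bidual_fst_inl bidual_fst_inr addr0.
have snd_join m : bidual_snd (joinf m) = m.2.
  transitivity (bidual_snd (bidual_inl m.1) + bidual_snd (bidual_inr m.2)).
    exact: dual_ext.
  by rewrite bidual_snd_inl bidual_snd_inr add0r.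
have joinZ m : joinf m \in @topcenter_pred R L.
  by apply: topcenter_lau; rewrite ?fst_join ?snd_join; exact: valP.
exists (fun m => TopCenter (joinZ m)) => [M|[m1 m2]].
  by apply/val_inj/bidual_lau_ext; [exact: fst_join|exact: snd_join].
by congr pair; apply: val_inj; [exact: fst_join|exact: snd_join].
Qed.

End LauBidual.

Theorem theorem4p4 (R : realType) (A B : banachAlgType R[i])
    (phi : character B) :
  alg_isomorphic (topcenter (lau_sum A B phi))
                 (lau_sum (topcenter A) (topcenter B) (bidual_character phi)).
Proof.
by exists (@topcenter_split R A B phi); split;
  [exact: topcenter_split_bij|exact: topcenter_splitM].
Qed.
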